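(* (BFSS solutions $\mathbb{R}_t\times\mathbb{R}^n\times_\xi T^n$ for $n\le 3$.) Let $n\in\{1,2,3\}$ and let $(U_i,X^i)$, $i=1,\dots,n$, be mutually commuting fuzzy cylinders with radii $R_i>0$ and NC moduli $\xi_i\in\mathbb{R}$. Let $\omega_i\in\mathbb{R}$ with $\omega_i^2=\xi_i^2$. Define nine Hermitian time-dependent matrices $X^1(t),\dots,X^9(t)$, $t\in\mathbb{R}$, by $$X^i(t)=X^i,\qquad X^{2i+2}(t)+iX^{2i+3}(t)=U_i\,e^{i\omega_it}\qquad (i=1,\dots,n),$$ where in the second formula the prefactor $i$ of $X^{2i+3}(t)$ and the $i$ in the exponent (multiplying $\omega_i t$) denote the imaginary unit, and with all remaining matrices equal to $0$. Then these matrices solve the BFSS equations of motion $$\ddot X^a(t)+\sum_{b=1}^9[X^b(t),[X^b(t),X^a(t)]]=0\qquad\text{for all }a=1,\dots,9\text{ and }t\in\mathbb{R}.$$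
   Context: Conventions: ''Matrices'' are operators on a separable Hilbert space; when they are unbounded, commutators and all identities are understood algebraically on a common invariant dense domain, so everything may be read as taking place in a unital complex $*$-algebra with involution $\dagger$. For a matrix $Z$ written as $Z=A+iB$ with $A,B$ Hermitian, $A=\tfrac12(Z+Z^\dagger)$ and $B=\tfrac1{2i}(Z-Z^\dagger)$. A dot denotes $d/dt$; the time dependence enters only through scalar factors $e^{\pm i\omega_i t}$, so derivatives are taken of these scalar coefficients. Fuzzy cylinder: a pair $(U,X)$ with $X=X^\dagger$ is a fuzzy cylinder with radius $R>0$ and NC modulus $\xi\in\mathbb{R}$ if $UU^\dagger=U^\dagger U=R^2\mathbf 1$, $[U,X]=\xi U$ and $[U^\dagger,X]=-\xi U^\dagger$. Two cylinders commute if every element of $\{U,U^\dagger,X\}$ of the first commutes with every such element of the second. *)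

(* Defs.v *)
From HB Require Import structures.
From mathcomp Require Import all_boot all_order all_algebra.
From mathcomp Require Import complex.
From mathcomp Require Import all_classical all_reals all_analysis.
From mathcomp Require Import zify ring.

Set Implicit Arguments.
Unset Strict Implicit.
Unset Printing Implicit Defensive.
Import Order.TTheory GRing.Theory Num.Theory.
Import numFieldNormedType.Exports.
Local Open Scope ring_scope.
Local Open Scope complex_scope.

Record star_involution (R : realType) (A : algType R[i]) (dag : A -> A) :
    Prop := StarInvolution {
  starK : forall x, dag (dag x) = x;
  starD : forall x y, dag (x + y) = dag x + dag y;
  starM : forall x y, dag (x * y) = dag y * dag x;
  starZ : forall (c : R[i]) x, dag (c *: x) = (c^*)%C *: dag x }.

Definition hermitian (R : realType) (A : algType R[i]) (dag : A -> A) (x : A) :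
  Prop := dag x = x.

Definition bracket (A : pzRingType) (x y : A) : A := x * y - y * x.

Definition expi (R : realType) (theta : R) : R[i] := cos theta +i* sin theta.

Record fuzzy_cylinder (R : realType) (A : algType R[i]) (dag : A -> A)
    (r xi : R) (U X : A) : Prop := FuzzyCylinder {
  cyl_radius_gt0 : 0 < r;
  cyl_herm : hermitian dag X;
  cyl_UUd : U * dag U = (r ^+ 2)%:C *: 1;
  cyl_UdU : dag U * U = (r ^+ 2)%:C *: 1;
  cyl_UX : bracket U X = xi%:C *: U;
  cyl_UdX : bracket (dag U) X = - (xi%:C *: dag U) }.

Definition cylinders_commute (R : realType) (A : algType R[i]) (dag : A -> A)
    (U X U' X' : A) : Prop :=
  forall x y, x \in [:: U; dag U; X] -> y \in [:: U'; dag U'; X'] ->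
    bracket x y = 0.

Definition cderiv (R : realType) (c c' : R -> R[i]) : Prop :=
  forall t : R,
    is_derive t 1 (fun s => complex.Re (c s)) (complex.Re (c' t)) /\
    is_derive t 1 (fun s => complex.Im (c s)) (complex.Im (c' t)).

(* The algebra carries no topology: a curve in A is differentiated through the
   scalar coefficients of a finite expansion over fixed elements of A.
   [scalar_deriv_uniq] below shows that the result does not depend on the
   chosen expansion. *)
Definition scalar_deriv (R : realType) (A : algType R[i]) (F F' : R -> A) :
    Prop :=
  exists (m : nat) (c c' : 'I_m -> R -> R[i]) (e : 'I_m -> A),
    [/\ forall k, cderiv (c k) (c' k),
        forall t, F t = \sum_(k < m) c k t *: e k
      & forall t, F' t = \sum_(k < m) c' k t *: e k].

(* Families are indexed from 1; values outside 1, ..., n (for the cylinders)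
   and 1, ..., 9 (for the matrices Y) are never used. *)
Record bfss_ansatz (R : realType) (A : algType R[i]) (dag : A -> A) (n : nat)
    (U X : nat -> A) (omega : nat -> R) (Y : nat -> R -> A) : Prop :=
    BfssAnsatz {
  ansatz_herm : forall a t, (1 <= a <= 9)%N -> hermitian dag (Y a t);
  ansatz_X : forall i t, (1 <= i <= n)%N -> Y i t = X i;
  ansatz_U : forall i t, (1 <= i <= n)%N ->
    Y (2 * i + 2)%N t + 'i%C *: Y (2 * i + 3)%N t = expi (omega i * t) *: U i;
  ansatz_rest : forall a t, (1 <= a <= 9)%N ->
    (forall i, (1 <= i <= n)%N ->
       [/\ a <> i, a <> (2 * i + 2)%N & a <> (2 * i + 3)%N]) ->
    Y a t = 0 }.

Definition bfss_solution (R : realType) (A : algType R[i])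
    (Y : nat -> R -> A) : Prop :=
  forall a, (1 <= a <= 9)%N ->
  exists dY ddY : R -> A,
    [/\ scalar_deriv (Y a) dY, scalar_deriv dY ddY
      & forall t, ddY t +
          \sum_(1 <= b < 10) bracket (Y b t) (bracket (Y b t) (Y a t)) = 0].

Section Sanity.
Variables (R : realType) (A : algType R[i]).
Implicit Types c d : R -> R[i].

Lemma cderiv_comb (a : R[i]) c c' d d' : cderiv c c' -> cderiv d d' ->
  cderiv (fun t => c t + a * d t) (fun t => c' t + a * d' t).
Proof.
move=> hc hd t; case: (hc t) => hc1 hc2; case: (hd t) => hd1 hd2.
case: a => a1 a2; split.
- rewrite (_ : (fun s => _) =
    (fun s => complex.Re (c s)) + (a1 \*: (fun s => complex.Re (d s)))
    - (a2 \*: (fun s => complex.Im (d s)))); last first.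
    by apply/funext => s; rewrite !fctE /=; case: (c s) (d s) => [? ?] [? ?] /=;
       rewrite /GRing.scale /=; ring.
  apply: is_derive_eq.
  by case: (c' t) (d' t) => [? ?] [? ?] /=; rewrite /GRing.scale /=; ring.
- rewrite (_ : (fun s => _) =
    (fun s => complex.Im (c s)) + (a1 \*: (fun s => complex.Im (d s)))
    + (a2 \*: (fun s => complex.Re (d s)))); last first.
    by apply/funext => s; rewrite !fctE /=; case: (c s) (d s) => [? ?] [? ?] /=;
       rewrite /GRing.scale /=; ring.
  apply: is_derive_eq.
  by case: (c' t) (d' t) => [? ?] [? ?] /=; rewrite /GRing.scale /=; ring.
Qed.

Lemma cderiv0 : cderiv (fun _ => 0 : R[i]) (fun _ => 0).
Proof. by move=> t; split; exact: is_derive_cst. Qed.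

Lemma cderiv_opp c c' : cderiv c c' ->
  cderiv (fun t => - c t) (fun t => - c' t).
Proof.
move=> h; have := cderiv_comb (-1) cderiv0 h.
by under eq_fun do rewrite add0r mulN1r;
   under [X in cderiv _ X]eq_fun do rewrite add0r mulN1r.
Qed.

Lemma cderiv_eq0 c c' : cderiv c c' -> (forall t, c t = 0) ->
  forall t, c' t = 0.
Proof.
move=> h c0 t; have [h1 h2] := h t.
apply/eqP; rewrite eq_complex /=; apply/andP; split; apply/eqP.
- have: is_derive t 1 (fun s => complex.Re (c s)) 0.
    by under eq_fun do rewrite c0 /=; exact: is_derive_cst.
  by move=> [_ <-]; case: h1 => _ <-.
- have: is_derive t 1 (fun s => complex.Im (c s)) 0.
    by under eq_fun do rewrite c0 /=; exact: is_derive_cst.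
  by move=> [_ <-]; case: h2 => _ <-.
Qed.

Lemma scalar_deriv_eq0 m (c c' : 'I_m -> R -> R[i]) (e : 'I_m -> A) :
  (forall k, cderiv (c k) (c' k)) ->
  (forall t, \sum_(k < m) c k t *: e k = 0) ->
  forall t, \sum_(k < m) c' k t *: e k = 0.
Proof.
elim: m => [|m IH] in c c' e * => hc h0 t; first by rewrite big_ord0.
have [[v [k0 [v0 hv]]]|free] := pselect (exists v : 'I_m.+1 -> R[i],
   exists k0, v k0 != 0 /\ \sum_(k < m.+1) v k *: e k = 0).
  have red (f : 'I_m.+1 -> R[i]) : \sum_(k < m.+1) f k *: e k =
     \sum_(j < m) (f (lift k0 j) + (- (v (lift k0 j) / v k0)) * f k0)
        *: e (lift k0 j).
    transitivity (\sum_(k < m.+1) f k *: e k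
                  - (f k0 / v k0) *: \sum_(k < m.+1) v k *: e k).
      by rewrite hv scaler0 subr0.
    rewrite scaler_sumr -sumrB (bigD1_ord k0) //= scalerA divfK // subrr add0r.
    apply: eq_bigr => j _; rewrite scalerA -scalerBl; congr (_ *: _); field.
    exact: v0.
  rewrite red.
  apply: (IH (fun j t => c (lift k0 j) t + (- (v (lift k0 j) / v k0)) * c k0 t)
             (fun j t => c' (lift k0 j) t + (- (v (lift k0 j) / v k0)) * c' k0 t)
             (fun j => e (lift k0 j))) => [j|s]; first exact: cderiv_comb.
  by rewrite -(red (fun k => c k s)).
rewrite big1 // => k _; rewrite (cderiv_eq0 (hc k)) ?scale0r // => s.
apply/eqP/negP => /negP ck; apply: free.
by exists (fun k => c k s), k.
Qed.

Lemma scalar_deriv_uniq (F F1 F2 : R -> A) :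
  scalar_deriv F F1 -> scalar_deriv F F2 -> F1 = F2.
Proof.
move=> [m1 [c1 [d1 [e1 [h1 s1 t1]]]]] [m2 [c2 [d2 [e2 [h2 s2 t2]]]]].
apply/funext => t; apply/eqP; rewrite -subr_eq0 t1 t2; apply/eqP.
pose glue T (f : 'I_m1 -> T) (g : 'I_m2 -> T) (k : 'I_(m1 + m2)) :=
  match fintype.split k with inl i => f i | inr j => g j end.
pose c := glue _ c1 (fun j t => - c2 j t).
pose d := glue _ d1 (fun j t => - d2 j t).
pose e := glue _ e1 e2.
have sumE (x : 'I_m1 -> R -> R[i]) (y : 'I_m2 -> R -> R[i]) s :
   \sum_k glue _ x (fun j t => - y j t) k s *: e k =
   \sum_k x k s *: e1 k - \sum_k y k s *: e2 k.
  rewrite big_split_ord -sumrN /=; congr (_ + _); apply: eq_bigr => k _.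
    by rewrite /e /glue (unsplitK (inl k)).
  by rewrite /e /glue (unsplitK (inr k)) scaleNr.
rewrite -sumE; apply: (scalar_deriv_eq0 (c := c)) => [k|s].
  rewrite /c /glue; case: (fintype.split k) => j //.
  exact: cderiv_opp.
by rewrite /c sumE -s1 -s2 subrr.
Qed.

Variable dag : A -> A.
Hypothesis dagP : star_involution dag.

Let hre (z : A) : A := 2^-1 *: (z + dag z).
Let him (z : A) : A := (2 * 'i%C)^-1 *: (z - dag z).

Let two_neq0 : (2 : R[i]) != 0. Proof. by rewrite pnatr_eq0. Qed.
Let i_neq0 : ('i%C : R[i]) != 0.
Proof. by rewrite eq_complex /= oner_eq0 andbF. Qed.

Let conji : ('i^*)%C = - 'i%C :> R[i].
Proof. by apply/eqP; rewrite eq_complex /= oppr0 !eqxx. Qed.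

Let dagN x : dag (- x) = - dag x.
Proof. by rewrite -scaleN1r (starZ dagP) rmorphN1 scaleN1r. Qed.

Let hreH z : hermitian dag (hre z).
Proof.
rewrite /hermitian /hre (starZ dagP) (starD dagP) (starK dagP) addrC.
by rewrite fmorphV rmorph_nat.
Qed.

Let himH z : hermitian dag (him z).
Proof.
rewrite /hermitian /him (starZ dagP) (starD dagP) dagN (starK dagP).
rewrite -[dag z - z]opprB scalerN -scaleNr; congr (_ *: _).
rewrite fmorphV rmorphM rmorph_nat.
apply: etrans (congr1 (fun x => - (2 * x)^-1) conji) _.
by rewrite mulrN invrN opprK.
Qed.

Let hreim z : hre z + 'i%C *: him z = z.
Proof.
rewrite /hre /him scalerA (_ : 'i%C * _ = 2^-1); last by field; rewrite i_neq0.
rewrite -scalerDr addrACA subrr addr0 -mulr2n.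
by rewrite -[z *+ 2]scaler_nat scalerA mulVf // scale1r.
Qed.

Let parts x y z : hermitian dag x -> hermitian dag y -> x + 'i%C *: y = z ->
  x = hre z /\ y = him z.
Proof.
move=> hx hy <-.
have -> : hre (x + 'i%C *: y) = 2^-1 *: (x *+ 2).
  rewrite /hre (starD dagP) (starZ dagP) hx hy.
  by rewrite conji scaleNr addrACA subrr addr0 -mulr2n.
have -> : him (x + 'i%C *: y) = (2 * 'i%C)^-1 *: (('i%C *: y) *+ 2).
  rewrite /him (starD dagP) (starZ dagP) hx hy.
  by rewrite conji scaleNr opprD opprK addrACA subrr add0r -mulr2n.
rewrite -[x *+ 2]scaler_nat -[('i%C *: y) *+ 2]scaler_nat !scalerA mulVf //.
by rewrite mulVf ?scale1r ?mulf_neq0.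
Qed.

Lemma bfss_ansatz_exists n (U X : nat -> A) (omega : nat -> R) :
  (n <= 3)%N -> (forall i, (1 <= i <= n)%N -> hermitian dag (X i)) ->
  exists Y, bfss_ansatz dag n U X omega Y.
Proof.
move=> n3 hX; pose Z i t := expi (omega i * t) *: U i.
exists (fun a t => if (a <= n)%N then X a else if (a < 4)%N then 0
  else if (2 * n + 3 < a)%N then 0
  else if odd a then him (Z (a - 3)./2 t) else hre (Z (a - 2)./2 t)).
have h0 : hermitian dag 0 by rewrite /hermitian -(scale0r 0) (starZ dagP) rmorph0 !scale0r.
split.
- move=> a t ha; case: ifP => [han|_]; first by apply: hX; lia.
  by do 3 ?case: ifP => _ //.
- by move=> i t /andP[_ ->].
- move=> i t hi.
  rewrite (_ : (2 * i + 2 <= n)%N = false); last lia.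
  rewrite (_ : (2 * i + 3 <= n)%N = false); last lia.
  rewrite (_ : (2 * i + 2 < 4)%N = false); last lia.
  rewrite (_ : (2 * i + 3 < 4)%N = false); last lia.
  rewrite (_ : (2 * n + 3 < 2 * i + 2)%N = false); last lia.
  rewrite (_ : (2 * n + 3 < 2 * i + 3)%N = false); last lia.
  rewrite (_ : odd (2 * i + 2) = false); last lia.
  rewrite (_ : odd (2 * i + 3) = true); last lia.
  rewrite (_ : (2 * i + 2 - 2)./2 = i); last lia.
  rewrite (_ : (2 * i + 3 - 3)./2 = i); last lia.
  exact: hreim.
- move=> a t ha hn; case: ifP => [han|an].
    by have [] : False by case: (hn a) => //; lia.
  case: ifP => a4 //; case: ifP => a2 //; exfalso.
  have [|h1 h2 h3] := hn (if odd a then (a - 3)./2 else (a - 2)./2).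
  by move: a4 a2; case: ifP; lia.
  by move: h2 h3; case: ifP; lia.
Qed.

Lemma bfss_ansatz_uniq n (U X : nat -> A) (omega : nat -> R) Y Y' :
  (n <= 3)%N -> bfss_ansatz dag n U X omega Y ->
  bfss_ansatz dag n U X omega Y' ->
  forall a t, (1 <= a <= 9)%N -> Y a t = Y' a t.
Proof.
move=> n3 [h1 h2 h3 h4] [k1 k2 k3 k4] a t ha.
have [han|an] := leqP a n; first by rewrite h2 ?k2 //; lia.
have [a4|a4] := ltnP a 4.
  by rewrite h4 ?k4 // => i hi; split; lia.
have [a2|a2] := ltnP (2 * n + 3) a.
  by rewrite h4 ?k4 // => i hi; split; lia.
pose i := if odd a then (a - 3)./2 else (a - 2)./2.
have hi : (1 <= i <= n)%N by rewrite /i; case: ifP; lia.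
have [p1 p2] := parts (h1 (2 * i + 2)%N t ltac:(lia)) (h1 (2 * i + 3)%N t ltac:(lia)) (h3 i t hi).
have [q1 q2] := parts (k1 (2 * i + 2)%N t ltac:(lia)) (k1 (2 * i + 3)%N t ltac:(lia)) (k3 i t hi).
have [oa|oa] := boolP (odd a).
  by rewrite (_ : a = (2 * i + 3)%N) ?p2 ?q2 // /i oa; lia.
by rewrite (_ : a = (2 * i + 2)%N) ?p1 ?q1 // /i (negbTE oa); lia.
Qed.

End Sanity.

(* Main.v *)
(** Every matrix of the ansatz is either [X i] or a combination of [U i] and
    its adjoint, with coefficients proportional to [exp(+- i omega_i t)].  On the
    span of [U i] and its adjoint, which is commutative, [ad (X i)] squares to
    [xi_i ^ 2], and two time derivatives give [- omega_i ^ 2].  Since [ad (X i)]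
    preserves this commutative span, every other double commutator within one
    cylinder vanishes. *)
Require Import Defs.
From mathcomp Require Import all_boot all_order all_algebra.
From mathcomp Require Import complex.
From mathcomp Require Import all_classical all_reals all_analysis.
From mathcomp Require Import zify ring.
Set Implicit Arguments.
Unset Strict Implicit.
Unset Printing Implicit Defensive.
Import Order.TTheory GRing.Theory Num.Theory.
Local Open Scope ring_scope.
Local Open Scope complex_scope.

(** * Commutator calculus *)

Lemma bracketxx (A : pzRingType) (x : A) : bracket x x = 0.
Proof. exact: subrr. Qed.

Lemma bracketC (A : pzRingType) (x y : A) : bracket x y = - bracket y x.
Proof. by rewrite /bracket opprB. Qed.

Lemma bracketx0 (A : pzRingType) (x : A) : bracket x 0 = 0.
Proof. by rewrite /bracket mulr0 mul0r subrr. Qed.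

Lemma bracket0x (A : pzRingType) (x : A) : bracket 0 x = 0.
Proof. by rewrite bracketC bracketx0 oppr0. Qed.

Lemma bracketDr (A : pzRingType) (x y z : A) :
  bracket x (y + z) = bracket x y + bracket x z.
Proof. by rewrite /bracket mulrDr mulrDl opprD addrACA. Qed.

Lemma bracketDl (A : pzRingType) (x y z : A) :
  bracket (x + y) z = bracket x z + bracket y z.
Proof. by rewrite bracketC bracketDr opprD -!(bracketC _ z). Qed.

Lemma bracketZr (K : comNzRingType) (A : algType K) (a : K) (x y : A) :
  bracket x (a *: y) = a *: bracket x y.
Proof. by rewrite /bracket -scalerAl -scalerAr scalerBr. Qed.

Lemma bracketZl (K : comNzRingType) (A : algType K) (a : K) (x y : A) :
  bracket (a *: x) y = a *: bracket x y.
Proof. by rewrite bracketC bracketZr -scalerN -bracketC. Qed.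

(** * Oscillating coefficients and their derivatives *)

Lemma conj_expi (R : realType) (theta : R) :
  ((expi theta)^*)%C = expi (- theta).
Proof. by rewrite /expi cosN sinN. Qed.

Lemma cderiv_expi (R : realType) (k : R[i]) (w : R) :
  cderiv (fun t => k * expi (w * t))
         (fun t => (k * ('i%C * w%:C)) * expi (w * t)).
Proof.
have d : cderiv (fun t => expi (w * t)) (fun t => ('i%C * w%:C) * expi (w * t)).
  move=> t.
  have dw : is_derive t 1 (fun s : R => w * s) w.
    rewrite (_ : (fun s : R => w * s) = w \*: id); last by apply/funext.
    by apply: is_derive_eq; rewrite /GRing.scale /= mulr1.
  split => /=.
    rewrite (_ : (fun s => _) = cos \o (fun s => w * s)) //.
    by apply: is_derive_eq; rewrite /GRing.scale /=; ring.
  rewrite (_ : (fun s => _) = sin \o (fun s => w * s)) //.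
  by apply: is_derive_eq; rewrite /GRing.scale /=; ring.
(* Adding [k] times a curve to the zero curve turns the combination rule into a rule for constant
   multiples. *)
have := cderiv_comb k (@cderiv0 R) d.
under eq_fun do rewrite add0r.
by under [X in cderiv _ X -> _]eq_fun do rewrite add0r mulrA.
Qed.

(** The amplitudes [k] and [l] are independent so that the family is closed under differentiation
    and contains both Hermitian parts of [expi (w * t) *: U], with [u] and [v] taken as [U] and its
    adjoint. *)
Definition wave (R : realType) (A : algType R[i]) (w : R) (k l : R[i])
    (u v : A) (t : R) : A :=
  (k * expi (w * t)) *: u + (l * expi (- w * t)) *: v.

Section Curves.
Variables (R : realType) (A : algType R[i]).

Lemma scalar_deriv_cst (x : A) : @scalar_deriv R A (fun=> x) (fun=> 0).
Proof.
exists 1, (fun _ _ => 1), (fun _ _ => 0), (fun=> x); split.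
- by move=> _ t; split; exact: is_derive_cst.
- by move=> t; rewrite big_ord1 scale1r.
- by move=> t; rewrite big_ord1 scale0r.
Qed.

Lemma scalar_deriv_wave w k l (u v : A) :
  scalar_deriv (wave w k l u v)
    (wave w (k * ('i%C * w%:C)) (l * ('i%C * (- w)%:C)) u v).
Proof.
pose pick T (x y : T) (j : 'I_2) := if j == ord0 then x else y.
pose c := pick _ (fun t => k * expi (w * t)) (fun t => l * expi (- w * t)).
pose c' := pick _ (fun t => (k * ('i%C * w%:C)) * expi (w * t))
                  (fun t => (l * ('i%C * (- w)%:C)) * expi (- w * t)).
exists 2, c, c', (pick _ u v); split.
- by move=> j; rewrite /c /c' /pick; case: ifP => _; exact: cderiv_expi.
- by move=> t; rewrite !big_ord_recl big_ord0 addr0.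
- by move=> t; rewrite !big_ord_recl big_ord0 addr0.
Qed.

(** The frequencies [w] and [- w] have the same square, so both amplitudes pick up the same
    factor. *)
Lemma wave_deriv2 w k l (u v : A) t :
  wave w (k * ('i%C * w%:C) * ('i%C * w%:C))
         (l * ('i%C * (- w)%:C) * ('i%C * (- w)%:C)) u v t
  = - ((w ^+ 2)%:C *: wave w k l u v t).
Proof.
have sq (m : R[i]) (x : R) :
    m * ('i%C * x%:C) * ('i%C * x%:C) = - ((x ^+ 2)%:C * m).
  rewrite -mulrA (mulrC _ m) -mulrN; congr (_ * _).
  by apply/eqP; rewrite eq_complex /=; apply/andP; split; apply/eqP; ring.
by rewrite /wave !sq sqrrN scalerDr !scalerA !mulrA opprD -!scaleNr !mulNr.
Qed.

End Curves.

(** Conjugating the imaginary unit gives [dag z] as [x - 'i *: y]; half the sum and half the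
    difference with [z] isolate the two parts. *)
Lemma hermitian_parts (R : realType) (A : algType R[i]) (dag : A -> A)
    (dagP : star_involution dag) (x y z : A) :
  Defs.hermitian dag x -> Defs.hermitian dag y -> x + 'i%C *: y = z ->
  x = 2^-1 *: z + 2^-1 *: dag z /\
  y = (2 * 'i%C)^-1 *: z + (- (2 * 'i%C)^-1) *: dag z.
Proof.
move=> hx hy <-.
have i0 : ('i%C : R[i]) != 0 by rewrite eq_complex /= oner_eq0 andbF.
have two0 : (2 : R[i]) != 0 by rewrite pnatr_eq0.
have conji : ('i^*)%C = - 'i%C :> R[i].
  by apply/eqP; rewrite eq_complex /= oppr0 !eqxx.
rewrite (starD dagP) (starZ dagP) hx hy conji scaleNr; split.
  rewrite -scalerDr addrACA subrr addr0 -mulr2n.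
  by rewrite -[x *+ 2]scaler_nat scalerA mulVf // scale1r.
rewrite scaleNr -scalerBr opprB addrC addrA subrK.
rewrite -mulr2n -[('i%C *: y) *+ 2]scaler_nat !scalerA mulVf ?mulf_neq0 //.
exact/esym/scale1r.
Qed.

(** * Double commutators within one cylinder *)

Section Cylinder.
Variables (R : realType) (A : algType R[i]) (dag : A -> A) (r xi : R).
Variables (U X : A).
Hypothesis cylP : fuzzy_cylinder dag r xi U X.

(** The cylinder relations make [U] and [dag U] eigenvectors of [bracket X], with opposite
    eigenvalues [- xi] and [xi]. *)
Lemma cyl_bracketX (a b : R[i]) :
  bracket X (a *: U + b *: dag U)
  = (- xi%:C * a) *: U + (xi%:C * b) *: dag U.
Proof.
rewrite bracketDr !bracketZr 2!(bracketC X) (cyl_UX cylP) (cyl_UdX cylP) opprK.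
by rewrite scalerN -scaleNr !scalerA; congr (_ *: _ + _ *: _); ring.
Qed.

(** [U] is normal: its two products with [dag U] are the same scalar. *)
Lemma cyl_bracketU (a b c d : R[i]) :
  bracket (a *: U + b *: dag U) (c *: U + d *: dag U) = 0.
Proof.
have UUd : bracket U (dag U) = 0.
  by rewrite /bracket (cyl_UUd cylP) (cyl_UdU cylP) subrr.
have UdU : bracket (dag U) U = 0 by rewrite bracketC UUd oppr0.
rewrite bracketDl !bracketZl !bracketDr !bracketZr !bracketxx UUd UdU.
by rewrite !scaler0 !addr0 !scaler0 addr0.
Qed.

Lemma cyl_bracketXX (a b : R[i]) :
  bracket X (bracket X (a *: U + b *: dag U))
  = (xi ^+ 2)%:C *: (a *: U + b *: dag U).
Proof.
rewrite !cyl_bracketX scalerDr !scalerA !mulrA mulrNN.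
by rewrite rmorphXn expr2.
Qed.

Lemma cyl_bracketUX (a b : R[i]) :
  bracket (a *: U + b *: dag U) (bracket (a *: U + b *: dag U) X) = 0.
Proof.
(* Once the sign is absorbed into the coefficients, the inner bracket lies in the span of [U] and
   [dag U]. *)
rewrite (bracketC _ X) cyl_bracketX -[- _]scaleN1r scalerDr !scalerA.
exact: cyl_bracketU.
Qed.

End Cylinder.

(** * The nine matrices of the ansatz and their equations of motion *)

Section Ansatz.
Variables (R : realType) (A : algType R[i]) (dag : A -> A).
Hypothesis dagP : star_involution dag.
Variables (n : nat) (U X : nat -> A) (r xi omega : nat -> R).
Variable Y : nat -> R -> A.
Hypothesis n3 : (n <= 3)%N.
Hypothesis YP : bfss_ansatz dag n U X omega Y.

Let Wave i k l := wave (omega i) k l (U i) (dag (U i)).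

Lemma ansatz_even i t : (1 <= i <= n)%N ->
  Y (2 * i + 2)%N t = Wave i 2^-1 2^-1 t.
Proof.
move=> hi.
have [+ _] := hermitian_parts dagP
  (ansatz_herm YP (a := 2 * i + 2) t ltac:(lia))
  (ansatz_herm YP (a := 2 * i + 3) t ltac:(lia)) (ansatz_U YP t hi).
by move=> ->; rewrite (starZ dagP) conj_expi -mulNr !scalerA.
Qed.

Lemma ansatz_odd i t : (1 <= i <= n)%N ->
  Y (2 * i + 3)%N t = Wave i (2 * 'i%C)^-1 (- (2 * 'i%C)^-1) t.
Proof.
move=> hi.
have [_] := hermitian_parts dagP
  (ansatz_herm YP (a := 2 * i + 2) t ltac:(lia))
  (ansatz_herm YP (a := 2 * i + 3) t ltac:(lia)) (ansatz_U YP t hi).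
by move=> ->; rewrite (starZ dagP) conj_expi -mulNr !scalerA.
Qed.

(** The indices of the matrices built from cylinder [i]. *)
Definition sector i := [:: i; (2 * i + 2)%N; (2 * i + 3)%N].

(** Commutation between sectors needs only the linear span, so the time dependence is hidden in the
    coefficients. *)
Lemma ansatz_sector i b t : (1 <= i <= n)%N -> b \in sector i ->
  exists p q s, Y b t = p *: U i + q *: dag (U i) + s *: X i.
Proof.
move=> hi; rewrite !inE => /or3P[]/eqP->.
- by exists 0, 0, 1; rewrite (ansatz_X YP) // !scale0r !add0r scale1r.
- by rewrite ansatz_even //; do 2 eexists; exists 0; rewrite scale0r addr0.
- by rewrite ansatz_odd //; do 2 eexists; exists 0; rewrite scale0r addr0.
Qed.

(** Sectors without a cylinder carry zero matrices, so the same three sectors serve for every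
    [n]. *)
Lemma ansatz_sector_gt i b t : (n < i <= 3)%N -> b \in sector i -> Y b t = 0.
Proof.
by move=> hi; rewrite !inE => hb; apply: (ansatz_rest YP); [|split]; lia.
Qed.

Hypothesis commP : forall i j, (1 <= i <= n)%N -> (1 <= j <= n)%N -> i <> j ->
  cylinders_commute dag (U i) (X i) (U j) (X j).

Lemma sectors_commute i j a b t : (1 <= i <= 3)%N -> (1 <= j <= 3)%N ->
  i <> j -> a \in sector i -> b \in sector j -> bracket (Y a t) (Y b t) = 0.
Proof.
move=> hi hj ij ha hb.
have [ni|ni] := ltnP n i.
  by rewrite (ansatz_sector_gt _ _ ha) ?bracket0x //; lia.
have [nj|nj] := ltnP n j.
  by rewrite (ansatz_sector_gt _ _ hb) ?bracketx0 //; lia.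
have [|p [q [s ->]]] := @ansatz_sector i a t _ ha; first lia.
have [|p' [q' [s' ->]]] := @ansatz_sector j b t _ hb; first lia.
have C x y := @commP i j ltac:(lia) ltac:(lia) ij x y.
(* Bilinearity leaves nine brackets between generators of two distinct cylinders, all zero by
   [commP]. *)
rewrite !(bracketDl, bracketDr, bracketZl, bracketZr).
by rewrite !C ?inE ?eqxx ?orbT // !(scaler0, addr0).
Qed.

Let dbl t b M := bracket (Y b t) (bracket (Y b t) M).

(** Outside the sector of [a] the inner bracket already vanishes, which leaves three of the nine
    terms. *)
Lemma ansatz_sum_sector j a t : (1 <= j <= 3)%N -> a \in sector j ->
  \sum_(1 <= b < 10) dbl t b (Y a t) = \sum_(b <- sector j) dbl t b (Y a t).
Proof.
move=> hj ha.
(* The sectors 1, 2, 3 partition {1, ..., 9}. *)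
have -> : \sum_(1 <= b < 10) dbl t b (Y a t) =
    \sum_(1 <= i < 4) \sum_(b <- sector i) dbl t b (Y a t).
  rewrite (perm_big (flatten [seq sector i | i <- index_iota 1 4])) //.
  by rewrite big_flatten big_map.
rewrite (bigD1_seq j) ?iota_uniq ?mem_index_iota //= [X in _ + X]big_nat_cond.
rewrite [X in _ + X]big1 ?addr0 // => i /andP[hi /eqP ij].
apply: big1_seq => b /= hb; rewrite /dbl (sectors_commute t _ _ ij hb ha) //.
exact: bracketx0.
Qed.

Hypothesis cylP : forall i, (1 <= i <= n)%N ->
  fuzzy_cylinder dag (r i) (xi i) (U i) (X i).
Hypothesis omegaP : forall i, (1 <= i <= n)%N -> omega i ^+ 2 = xi i ^+ 2.

Lemma bfss_X j t : (1 <= j <= n)%N ->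
  \sum_(1 <= b < 10) dbl t b (Y j t) = 0.
Proof.
move=> hj; rewrite (@ansatz_sum_sector j) ?inE ?eqxx //; last lia.
rewrite !big_cons big_nil /dbl ansatz_even // ansatz_odd // (ansatz_X YP) //.
by rewrite bracketxx bracketx0 !(cyl_bracketUX (cylP hj)) !addr0.
Qed.

(** The two oscillating matrices of the sector commute with the wave; only [X j] contributes, by
    [xi j ^+ 2], and [omegaP] turns this into the squared frequency. *)
Lemma bfss_wave j a t k l : (1 <= j <= n)%N -> a \in sector j ->
  Y a t = Wave j k l t ->
  \sum_(1 <= b < 10) dbl t b (Y a t) = (omega j ^+ 2)%:C *: Y a t.
Proof.
move=> hj ha Ya; rewrite (ansatz_sum_sector _ _ ha); last lia.
rewrite !big_cons big_nil /dbl ansatz_even // ansatz_odd // (ansatz_X YP) // Ya.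
rewrite (cyl_bracketXX (cylP hj)) !(cyl_bracketU (cylP hj)) !bracketx0 !addr0.
by rewrite omegaP.
Qed.

(** The two Hermitian parts differ only in their amplitudes, so one argument covers both: the
    acceleration cancels the squared frequency from [bfss_wave]. *)
Lemma bfss_wave_eq j a k l : (1 <= j <= n)%N -> a \in sector j ->
  (forall t, Y a t = Wave j k l t) ->
  exists dY ddY : R -> A,
    [/\ scalar_deriv (Y a) dY, scalar_deriv dY ddY
      & forall t, ddY t + \sum_(1 <= b < 10) dbl t b (Y a t) = 0].
Proof.
move=> hj ha Ya; have -> : Y a = Wave j k l by apply/funext.
do 2 eexists; split; [exact: scalar_deriv_wave | exact: scalar_deriv_wave |].
move=> t; rewrite -Ya (bfss_wave hj ha (Ya t)) wave_deriv2 Ya.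
exact: addNr.
Qed.

Lemma bfss_ansatz_solution : bfss_solution Y.
Proof.
move=> a ha.
(* An index in no sector up to [n] belongs to a zero matrix; otherwise its position in the sector
   decides between a static matrix and a wave. *)
have [[j [hj aj]]|none] :=
  pselect (exists j, (1 <= j <= n)%N /\ a \in sector j); last first.
  have Ya t : Y a t = 0.
    apply: (ansatz_rest YP) => // i hi.
    by split=> ai; apply: none; exists i; rewrite !inE ai eqxx ?orbT.
  have -> : Y a = fun=> 0 by apply/funext.
  exists (fun=> 0), (fun=> 0); split; do ?exact: scalar_deriv_cst.
  by move=> t; rewrite big1 ?addr0 // => b _; rewrite !bracketx0.
move: (aj); rewrite !inE => /or3P[]/eqP aE.
- have -> : Y a = fun=> X j by apply/funext => t; rewrite aE (ansatz_X YP).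
  exists (fun=> 0), (fun=> 0); split; do ?exact: scalar_deriv_cst.
  by move=> t; rewrite add0r -(ansatz_X YP t hj); exact: bfss_X.
- by apply: (bfss_wave_eq hj aj) => t; rewrite aE ansatz_even.
- by apply: (bfss_wave_eq hj aj) => t; rewrite aE ansatz_odd.
Qed.

End Ansatz.

Theorem mainTheorem6 (R : realType) (A : algType R[i]) (dag : A -> A)
    (dagP : star_involution dag)
    (n : nat) (n_range : (1 <= n <= 3)%N)
    (U X : nat -> A) (r xi omega : nat -> R)
    (cylP : forall i, (1 <= i <= n)%N ->
       fuzzy_cylinder dag (r i) (xi i) (U i) (X i))
    (commP : forall i j, (1 <= i <= n)%N -> (1 <= j <= n)%N -> i <> j ->
       cylinders_commute dag (U i) (X i) (U j) (X j))
    (omegaP : forall i, (1 <= i <= n)%N -> omega i ^+ 2 = xi i ^+ 2)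
    (Y : nat -> R -> A) (YP : bfss_ansatz dag n U X omega Y) :
  bfss_solution Y.
Proof.
have [_ n3] := andP n_range.
exact: (bfss_ansatz_solution dagP n3 YP commP cylP omegaP).
Qed.
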